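(* Let $X$ be a metrizable space. Then the nabla product $\nabla X^\omega$ is hereditarily $D$. If $X$ has weight no more than $\mathfrak{d}$, then the box product $\square X^\omega$ is hereditarily $D$.
   Context: $\mathfrak{d}$ is the minimal size of a cofinal family in $\omega^\omega$ with the coordinatewise order. The weight of $X$ is the minimal size of a base. A neighbornet on a space $(X,\tau)$ is a map $U:X\to\tau$ with $x\in U(x)$ for all $x\in X$. $X$ is a $D$-space if for every neighbornet $U$ on $X$ there is a closed discrete $D\subseteq X$ with $\bigcup_{x\in D}U(x)=X$. A space is hereditarily $D$ if each of its subspaces is a $D$-space. $\square X^\omega$ is the set $X^\omega$ with the topology generated by all sets $\prod_{n\in\omega} U_n$ with every $U_n$ open in $X$. $\nabla X^\omega$ is the quotient space $(\square X^\omega)/{=^*}$, where $x=^*y$ iff $x(n)=y(n)$ for all but finitely many $n$. *)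

(* Defs.v *)
From HB Require Import structures.
From mathcomp Require Import all_boot all_order all_algebra.
From mathcomp Require Import all_classical all_reals all_analysis.

Set Implicit Arguments.
Unset Strict Implicit.
Unset Printing Implicit Defensive.

Import Order.TTheory GRing.Theory Num.Theory.

Local Open Scope classical_set_scope.
Local Open Scope card_scope.
Local Open Scope ring_scope.
Local Open Scope quotient_scope.

(* Metrizability is a property of the topology, so the metric is existentially
   quantified; its axioms are those of the factory [isMetric], and
   nonnegativity follows from them. *)
Definition metrizable (R : realType) (X : topologicalType) : Prop :=
  exists d : X -> X -> R,
    [/\ forall x y, d x y = 0 <-> x = y,
        forall x y, d x y = d y x,
        forall x y z, d x z <= d x y + d y z
      & forall x, nbhs x = nbhs_ball_ (fun y e => [set z | d y z < e]) x].

(* Cardinals are represented by sets realizing them: [A] has the minimal size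
   among the sets satisfying [P]. *)
Definition min_size (T : Type) (P : set (set T)) (A : set T) : Prop :=
  P A /\ forall B, P B -> A #<= B.

Definition cofinal_family (F : set (nat -> nat)) : Prop :=
  forall f : nat -> nat, exists2 g, F g & forall n, (f n <= g n)%N.

(* w(X) <= d, where [B] has cardinality w(X) and [F] has cardinality d. *)
Definition weight_le_d (X : topologicalType) : Prop :=
  exists (B : set (set X)) (F : set (nat -> nat)),
    [/\ min_size (@basis X) B, min_size cofinal_family F & B #<= F].

Definition neighbornet (X : topologicalType) (U : X -> set X) : Prop :=
  forall x, open (U x) /\ U x x.

Definition discrete_set (X : topologicalType) (D : set X) : Prop :=
  D `<=` isolated D.

Definition D_space (X : topologicalType) : Prop :=
  forall U : X -> set X, neighbornet U ->
    exists D : set X,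
      [/\ closed D, discrete_set D & \bigcup_(x in D) U x = [set: X]].

(* The subset [A] is coerced to the type [set_type A], which carries the
   subspace topology. The library's [subspace A] would be wrong here: it keeps
   all the points of [X] and isolates those outside [A]. *)
Definition hereditarily_D (X : topologicalType) : Prop :=
  forall A : set X, D_space A.

Definition box (X : Type) : Type := nat -> X.

Section box_topology.
Context {X : topologicalType}.

Definition open_box (U : nat -> set X) : set (box X) :=
  [set x | forall n, U n (x n)].

Let open_factors : set (nat -> set X) := [set U | forall n, open (U n)].

Let open_box_cover : \bigcup_(U in open_factors) open_box U = [set: box X].
Proof.
by apply/seteqP; split=> // x _; exists (fun=> setT) => // n; exact: openT.
Qed.

Let open_box_join U V x : open_factors U -> open_factors V ->
  open_box U x -> open_box V x ->
  exists W, [/\ open_factors W, open_box W x &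
                open_box W `<=` open_box U `&` open_box V].
Proof.
move=> oU oV Ux Vx; exists (fun n => U n `&` V n); split.
- by move=> n; exact: openI.
- by move=> n; split.
- by move=> y UVy; split=> n; have [] := UVy n.
Qed.

HB.instance Definition _ := Choice.copy (box X) (nat -> X).
HB.instance Definition _ :=
  isBaseTopological.Build (box X) open_box_cover open_box_join.

End box_topology.

Section nabla.
Context {X : topologicalType}.

Definition eq_star (x y : box X) : bool :=
  `[< finite_set [set n | x n <> y n] >].

Let eq_star_refl : reflexive eq_star.
Proof.
move=> x; apply/asboolP; rewrite (_ : [set _ | _] = set0) //.
by apply/seteqP; split=> n.
Qed.

Let eq_star_sym : symmetric eq_star.
Proof.
move=> x y; rewrite /eq_star; congr (`[< finite_set _ >]).
by apply/seteqP; split=> n /= /nesym.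
Qed.

Let eq_star_trans : transitive eq_star.
Proof.
move=> y x z /asboolP xy /asboolP yz; apply/asboolP.
apply: (@sub_finite_set _ _ ([set n | x n <> y n] `|` [set n | y n <> z n])).
  move=> n /= xz; have [xyn|] := pselect (x n = y n); last by left.
  by right; rewrite -xyn.
by rewrite finite_setU.
Qed.

Definition eq_star_equiv := EquivRel eq_star eq_star_refl eq_star_sym eq_star_trans.

End nabla.

Definition nabla (X : topologicalType) : Type :=
  {eq_quot (@eq_star_equiv X)}.

HB.instance Definition _ (X : topologicalType) :=
  Topological.copy (nabla X) (quotient_topology (nabla X)).
HB.instance Definition _ (X : topologicalType) := Quotient.on (nabla X).

(* Main.v *)
Require Import Defs.
From mathcomp Require Import all_boot all_order all_algebra.
From mathcomp Require Import all_classical all_reals all_analysis.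
From mathcomp Require Import wochoice lra.

(** Fix a metric [d] on [X].  In both products a point has a neighbourhood base
    indexed by functions [f : nat -> nat]: the points [z] with
    [d (x n) (z n) < 1 / (f n + 1)] for all [n] (box product) or for almost all
    [n] (nabla product).  Letting [f] run through a dominating family indexed by
    a set [I] of the least possible size, each point gets a base of size at most
    the dominating number.  The proof transposes to this cardinal the theorem of
    Arhangel'skii and Buzyakova that a space with a point-countable base is a
    D-space; finite sets are replaced by sets of fewer points than the
    dominating number, and these are closed discrete in a nabla product
    ([few_classes_far], [small_union_closed_discrete]): if [x] is not eventually
    equal to any of the few points [y j], let [h j n] measure the distance of [x]
    to [y j] at some coordinate [k >= n] where they differ.  The functions [h j]
    are too few to dominate, and a function that escapes all of them gives a
    neighbourhood of [x] missing every [y j].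

    The abstract argument is [covering_closed_discrete].  Call [D] absorbing if
    every [x] whose basic neighbourhood, chosen well inside [U x], meets [D] is
    already covered by the neighbourhoods [U y], [y \in D].  An absorbing set is
    automatically closed discrete away from the part that it covers.  Zorn's
    lemma applies to the closed discrete absorbing sets, ordered by extensions
    that add only uncovered points.  That a maximal one covers the space is
    [absorbing_extension]: from an uncovered point, a recursion of length [I]
    takes care one by one of the tasks (point [y] already chosen, radius index
    [a]): if some [x] of index [a] with [y] in its neighbourhood is still
    uncovered, choose one such [x].  By the triangle inequality [U x] then
    contains all the other ones, so that [I] has room for all the tasks, and no
    base of [X] with disjointness properties is needed.  Every stage has few
    predecessors, so only few chosen points are near a covered point, and the
    result is closed discrete.

    In a box product few points may cluster, but only inside one class of
    eventual equality; so each stage covers at once the whole class of its new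
    point by a closed discrete subset of the class.  A class is a countable union
    of pieces that look like finite powers of [X], and a maximal separated subset
    of a piece does the job.  The recursion has time for all the points added in
    this way only if they are at most [I] many: this is where the bound on
    the weight of [X] enters ([box_hereditarily_D]).  In a nabla product the
    classes are points, and no bound is needed ([nabla_hereditarily_D]).

    The cardinal arithmetic that this bookkeeping requires is built into the
    index set ([dominating_index_exists]), whose elements are finite sequences,
    so that [I] trivially maps onto [I * I]. *)

Set Implicit Arguments.
Unset Strict Implicit.
Unset Printing Implicit Defensive.

Import Order.TTheory GRing.Theory Num.Theory.

Local Open Scope classical_set_scope.
Local Open Scope card_scope.

(** * Well-orders *)

Definition strict_wo (T : Type) (lt : T -> T -> Prop) : Prop :=
  [/\ forall x y z, lt x y -> lt y z -> lt x z,
      forall x y, [\/ x = y, lt x y | lt y x]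
    & well_founded lt].

Lemma wf_min (T : Type) (lt : T -> T -> Prop) (P : set T) x :
  well_founded lt -> P x -> exists2 z, P z & forall y, P y -> ~ lt y z.
Proof.
move=> wf; elim: (wf x) => y _ IH Py.
have [[z [Pz zy]]|nz] := pselect (exists z, P z /\ lt z y); first exact: IH Pz.
by exists y => // z Pz zy; apply: nz; exists z.
Qed.

Lemma min_wf (T : Type) (lt : T -> T -> Prop) :
  (forall P : set T, P !=set0 -> exists2 z, P z & forall y, P y -> ~ lt y z) ->
  well_founded lt.
Proof.
move=> minP x; apply: contrapT => nx.
have [|z nz zmin] := minP [set y | ~ Acc lt y]; first by exists x.
by apply: nz; split=> y yz; apply: contrapT => ny; exact: zmin ny yz.
Qed.

Lemma strict_wo_exists (T : Type) : exists lt : T -> T -> Prop, strict_wo lt.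
Proof.
pose T' := {classic T}; have [R Rwo] := well_ordering_principle T'.
have Rmin (P : set T') x : P x -> exists2 z, P z & forall y, P y -> R z y.
  move=> Px; have [|z [[/asboolP Pz zmin] _]] := Rwo (fun y => `[< P y >]).
    by exists x; apply/asboolP.
  by exists z => // y Py; apply: zmin; apply/asboolP.
have Ranti x y : R x y -> R y x -> x = y.
  move=> xy yx.
  have [|z [_ zuniq]] := Rwo (fun u => `[< u = x \/ u = y >]).
    by exists x; apply/asboolP; left.
  have Rxx u : R u u by have [v <- ->] := Rmin [set u] u erefl.
  have zE u : u = x \/ u = y -> z = u.
    by move=> uxy; apply: zuniq; split=> [|v /asboolP[]->];
      [exact/asboolP|case: uxy => ->..].
  by rewrite -(zE x (or_introl erefl)); apply: zE; right.
exists (fun x y : T' => R x y /\ x <> y); split.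
- move=> x y z [xy nxy] [yz nyz].
  have [u] := Rmin [set u | [\/ u = x, u = y | u = z]] x (Or31 _ _ erefl).
  case=> -> umin; have := (umin x (Or31 _ _ erefl), umin y (Or32 _ _ erefl),
    umin z (Or33 _ _ erefl)) => -[[ux uy] uz].
  + by split=> // xz; apply: nyz; apply: Ranti => //; rewrite -xz.
  + by case: nxy; apply: Ranti.
  + by case: nyz; apply: Ranti.
- move=> x y; have [->|nxy] := pselect (x = y); first by constructor 1.
  have [u [->|->] umin] := Rmin [set u | u = x \/ u = y] x (or_introl erefl).
    by constructor 2; split=> //; apply: umin; right.
  by constructor 3; split; [apply: umin; left|exact/nesym].
- apply: min_wf => P [x Px]; have [z Pz zmin] := Rmin P x Px.
  by exists z => // y Py [yz]; apply; apply: Ranti => //; exact: zmin.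
Qed.

Lemma lex_strict_wo (L T : Type) (ltL : L -> L -> Prop) (ltT : T -> T -> Prop)
    (r : L -> T) : strict_wo ltL -> strict_wo ltT ->
  strict_wo (fun s t => ltT (r s) (r t) \/ (r s = r t /\ ltL s t)).
Proof.
move=> [trL totL wfL] [trT totT wfT]; split.
- move=> x y z [xy|[exy xy]] [yz|[eyz yz]].
  + by left; apply: trT yz.
  + by left; rewrite -eyz.
  + by left; rewrite exy.
  + by right; split; [rewrite exy|apply: trL yz].
- move=> x y; have [exy|xy|yx] := totT (r x) (r y).
  + have [->|xy|yx] := totL x y; first by constructor 1.
      by constructor 2; right.
    by constructor 3; right.
  + by constructor 2; left.
  + by constructor 3; left.
- apply: min_wf => P [x Px].
  have [_ [y Py <-] ymin] := @wf_min _ _ (r @` P) (r x) wfT (imageP _ Px).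
  have [z [Pz ezy] zmin] :=
    @wf_min _ _ (P `&` [set z | r z = r y]) y wfL (conj Py erefl).
  exists z => // t Pt [tz|[etz tz]].
    by apply: (ymin (r t)); [exists t|rewrite -ezy].
  by apply: (zmin t) => //; split; rewrite //= etz.
Qed.

(** * An index set for a least dominating family *)

Definition star_dominating (J : Type) (S : set J) (h : J -> nat -> nat) : Prop :=
  forall f : nat -> nat, exists2 j, S j & \forall n \near \oo, (f n <= h j n)%N.

Lemma countable_not_star_dominating (h : nat -> nat -> nat) :
  ~ star_dominating setT h.
Proof.
move=> /(_ (fun n => (\max_(m < n.+1) h m n).+1)) [m _ [N _ mN]].
have /= := mN (maxn m N) (leq_maxr _ _); rewrite ltnNge => /negP; apply.
have mlt : (m < (maxn m N).+1)%N by rewrite ltnS leq_maxl.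
exact: (@leq_bigmax _ (fun i : 'I__ => h i (maxn m N)) (Ordinal mlt)).
Qed.

(** An initial segment of [I], even with its endpoint, indexes no family that
    dominates modulo finite sets; hence the size of [I] is the dominating number.
    The two surjections stand for the equations [d * d = d] and
    [aleph_0 * d = d]. *)
Record dominating_index (I : Type) (lt : I -> I -> Prop) (g : I -> nat -> nat) :
    Prop := DominatingIndex {
  dindex_wo : strict_wo lt ;
  dindex_dom : forall f : nat -> nat, exists i, forall n, (f n <= g i n)%N ;
  dindex_small : forall i (h : I -> nat -> nat),
    ~ star_dominating [set j | ~ lt i j] h ;
  dindex_pair : exists p : I -> I * I, forall t, exists i, p i = t ;
  dindex_nat : exists p : I -> nat, forall n, exists i, p i = n }.

Section dominating_index_existence.
Context {T : Type}.
Implicit Types (J : set T) (s : seq (nat + T)).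

Definition entries_in J s :=
  all (fun x => if x is inr b then `[< J b >] else true) s.

(** Finite sequences over [J], padded with natural numbers, replace [J] itself:
    being smaller than the least [J] with this property is then stable under
    products and under adding countably many elements, without any appeal to
    Hessenberg's theorem. *)
Definition indexes_dominating J : Prop :=
  exists h : seq (nat + T) -> nat -> nat, star_dominating (entries_in J) h.

Lemma entries_in_sub J J' s : J `<=` J' -> entries_in J s -> entries_in J' s.
Proof.
by move=> JJ'; apply: sub_all => -[//|b] /asboolP Jb; apply/asboolP/JJ'.
Qed.

Lemma indexes_dominating_sub J J' :
  J `<=` J' -> indexes_dominating J -> indexes_dominating J'.
Proof.
move=> JJ' [h hJ]; exists h => f; have [s sJ fs] := hJ f.
by exists s => //; exact: entries_in_sub sJ.
Qed.

(** The natural numbers among the entries leave room for one more letter: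
    [0] stands for [a] and [n + 1] for [n]. *)
Lemma indexes_dominating_add1 J a :
  indexes_dominating (J `|` [set a]) -> indexes_dominating J.
Proof.
pose dec (x : nat + T) :=
  match x with inl 0 => inr a | inl n.+1 => inl n | inr b => inr b end.
pose enc (x : nat + T) : nat + T := match x with
  | inl n => inl n.+1 | inr b => if pselect (b = a) then inl 0 else inr b end.
move=> [h hJ]; exists (h \o map dec) => f; have [s sJ fs] := hJ f.
exists (map enc s); last first.
  rewrite /= mapK // => -[//|b] /=.
  by case: pselect => [ba|] /=; rewrite ?ba.
rewrite /entries_in all_map; apply: sub_all sJ => -[//|b] /asboolP /=.
by case: pselect => [_ _ //|nba [Jb|//]]; apply/asboolP.
Qed.

Lemma not_indexes_dominating0 : ~ indexes_dominating set0.
Proof.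
move=> [h hdom].
apply: (@countable_not_star_dominating
  (fun m => h (map inl (odflt [::] (unpickle m : option (seq nat)))))) => f.
have [s s0 fs] := hdom f.
have [u us] : exists u : seq nat, s = map inl u.
  elim: s s0 {fs} => [|x s IH] /=; first by exists [::].
  move=> /andP[x0 /IH[u ->]]; case: x x0 => [n _|b /asboolP //].
  by exists (n :: u).
by exists (pickle u) => //; rewrite pickleK /= -us.
Qed.

End dominating_index_existence.

(** Well-order [T], the type of all functions, and let [K] be the least initial
    segment whose finite sequences index a dominating family.  The sequences
    over [K] are ordered by their largest entry in [K] first, ties being broken
    by an arbitrary well-order; so those that do not exceed [s] are sequences
    over a segment of [K] with an endpoint, which is too small. *)
Theorem dominating_index_exists : exists (I : Type) lt (g : I -> nat -> nat),
  dominating_index lt g.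
Proof.
pose T := nat -> nat; have [lt wolt] := strict_wo_exists T.
have [ltT lt_tot lt_wf] := wolt.
pose below (b : T) := [set c | ~ lt b c].
pose K := [set b | ~ indexes_dominating (below b)].
have belowE a : below a `<=` [set b | lt b a] `|` [set a].
  by move=> c nac; have [->|//|] := lt_tot a c; [right|left].
have Kdom : indexes_dominating K.
  have [KT|/existsNP[x nKx]] := pselect (forall b, K b).
    exists (fun s => if s is inr b :: _ then b else id) => f.
    exists [:: inr f]; first by rewrite /entries_in /= andbT; exact/asboolP.
    by apply: nearW => n.
  have [a /contrapT adom amin] := @wf_min _ _ (~` K) x lt_wf nKx.
  apply: (@indexes_dominating_add1 _ _ a).
  apply: indexes_dominating_sub adom => c /belowE[ca|]; last by right.
  by left; apply: contrapT => /amin.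
have [b0 _ b0min] := @wf_min _ _ setT (id : T) lt_wf Logic.I.
have Kb0 : K b0.
  move=> b0dom; apply: (@not_indexes_dominating0 T).
  apply: (@indexes_dominating_add1 _ _ b0).
  by apply: indexes_dominating_sub b0dom => c /belowE[/(b0min c Logic.I)[]|->]; right.
pose I := seq (nat + {b | K b}).
pose emb : I -> seq (nat + T) :=
  map (fun x => match x with inl n => inl n | inr b => inr (sval b) end).
pose mx := foldr (fun (x : nat + {b | K b}) c => if x is inr b then
  (if pselect (lt c (sval b)) then sval b else c) else c) b0.
have Kmx s : K (mx s).
  by elim: s => //= -[//|[b Kb]] s IH /=; case: pselect.
have emb_mx s c : ~ lt c (mx s) -> entries_in (below c) (emb s).
  elim: s => //= -[n|[b Kb]] s IH //= ncs; apply/andP; split.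
    apply/asboolP => /=; case: pselect ncs => //= nsb ncs cb.
    have [sc|cs|sc] := lt_tot (mx s) c; first by apply: nsb; rewrite sc.
      by apply: nsb; apply: ltT cb.
    by [].
  apply: IH => cs; move: ncs; case: pselect => // sb; apply.
  exact: ltT sb.
have [ltI woI] := strict_wo_exists I.
have [h hK] := Kdom.
have hI f : exists s : I, \forall n \near \oo, (f n <= h (emb s) n)%N.
  have [s sK fs] := hK f.
  suff [t ts] : exists t, emb t = s by exists t; rewrite ts.
  elim: s sK {fs} => [|x s IH] /=; first by exists [::].
  move=> /andP[xK /IH[t <-]]; case: x xK => [n _|b /asboolP Kb].
    by exists (inl n :: t).
  by exists (inr (exist _ b Kb) :: t).
exists I, (fun s t => lt (mx s) (mx t) \/ (mx s = mx t /\ ltI s t)).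
(* the leading number [m] absorbs the finitely many exceptions, which makes
   the family dominate everywhere *)
exists (fun s n => if s is inl m :: t then maxn m (h (emb t) n) else 0%N).
split.
- exact: lex_strict_wo.
- move=> f; have [s [N _ sN]] := hI f.
  exists (inl (\max_(m < N) f m) :: s) => n; rewrite leq_max.
  have [nN|Nn] := ltnP n N; last by rewrite [X in _ || X](sN n Nn) orbT.
  by rewrite (@leq_bigmax _ (fun i : 'I__ => f i) (Ordinal nN)).
- move=> s k kdom; apply: (Kmx s).
  exists (fun u => if pselect (exists t, emb t = u) is left e
    then k (projT1 (cid e)) else id) => f.
  have embI : injective emb.
    apply: inj_map => -[n|[b Kb]] [m|[c Kc]] //= [].
      by move=> ->.
    move=> bc; rewrite bc in Kb *.
    by congr (inr (exist _ _ _)); exact: Prop_irrelevance.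
  have [t /= nst ft] := kdom f; exists (emb t).
    by apply: emb_mx => st; apply: nst; left.
  case: pselect => [e|[]]; last by exists t.
  by case: cid => /= t' /embI ->.
- exists (fun s => if s is inl n :: t then (take n t, drop n t) else (s, s)).
  case=> s t; exists (inl (size s) :: s ++ t).
  by rewrite take_size_cat // drop_size_cat.
- exists (fun s => if s is inl n :: _ then n else 0%N).
  by move=> n; exists [:: inl n].
Qed.

(** * Closed discrete sets *)

Definition closed_discrete (Y : topologicalType) (D : set Y) : Prop :=
  forall x : Y, \forall y \near x, D y -> y = x.

Lemma closed_discreteP (Y : topologicalType) (D : set Y) :
  closed_discrete D -> closed D /\ discrete_set D.
Proof.
move=> cd; split=> x Dx.
  have [y [Dy yx]] := Dx _ (cd x).
  by rewrite -(yx Dy).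
split; first exact: mem_set.
exists [set y | D y -> y = x]; first exact: cd.
apply/seteqP; split=> y /=; first by case=> yx Dy; exact: yx.
by move=> ->; split.
Qed.

Section closed_discrete_sets.
Context {Y : topologicalType}.
Implicit Types (D : set Y) (U : Y -> set Y).

Lemma closed_discrete0 : closed_discrete (set0 : set Y).
Proof. by move=> x; apply: nearW. Qed.

Lemma closed_discrete1 (x : Y) :
  (forall y, y <> x -> \forall z \near y, z <> x) -> closed_discrete [set x].
Proof.
move=> x_far y; have [->|/x_far] := pselect (y = x).
  by apply: nearW => z ->.
by apply: filterS => z zx /zx.
Qed.

Lemma closed_discreteU D D' :
  closed_discrete D -> closed_discrete D' -> closed_discrete (D `|` D').
Proof.
by move=> cD cD' x; near=> y => -[]; near: y; [exact: cD|exact: cD'].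
Unshelve. all: by end_near. Qed.

Definition star U D : set Y := \bigcup_(x in D) U x.

Lemma star_sub U D D' : D `<=` D' -> star U D `<=` star U D'.
Proof. by move=> DD' z [x Dx Uz]; exists x => //; exact: DD'. Qed.

Lemma open_star U D : neighbornet U -> open (star U D).
Proof. by move=> nU; apply: bigcup_open => x _; have [] := nU x. Qed.

End closed_discrete_sets.

(** Course-of-values recursion with a total function of the earlier values:
    those that are not available yet are replaced by [v0]. *)
Lemma wf_recursion (I : Type) (lt : I -> I -> Prop) (V : Type) (v0 : V)
    (step : I -> (I -> V) -> V) : well_founded lt ->
  exists E : I -> V, forall i,
    E i = step i (fun j => if pselect (lt j i) then E j else v0).
Proof.
move=> wf.
pose F i (E : forall j, lt j i -> V) :=
  step i (fun j => if pselect (lt j i) is left h then E j h else v0).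
exists (Fix wf (fun=> V) F) => i; rewrite Fix_eq.
  by congr (step i); apply/funext => j; case: pselect.
move=> j f g fg; congr (step j); apply/funext => k.
by case: pselect.
Qed.

(** * The covering argument *)

Section covering.
Context {Y : topologicalType}.
(* [S a y] consists of the points [x] whose basic neighbourhood has index [a]
   and contains [y]; the stage [i] is devoted to the task [t i], consisting of an
   earlier stage, a number for a point [y] chosen there, and an index [a]. *)
Variables (U : Y -> set Y) (eqv : Y -> Y -> Prop).
Variables (I : Type) (lt : I -> I -> Prop) (S : I -> Y -> set Y).

Definition absorbing (D W : set Y) : Prop :=
  forall y a x, D y -> S a y x -> W x.

Hypothesis nU : neighbornet U.
Hypothesis wolt : strict_wo lt.
Hypothesis tasks : exists t : I -> I * (I * I), forall u, exists2 i, lt u.1 i & t i = u.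
Hypothesis S_sub : forall a y x, S a y x -> S a y `<=` U x.
Hypothesis S_near : forall x, exists a, \forall y \near x, S a y x.
Hypothesis eqv_sym : forall x y, eqv x y -> eqv y x.
Hypothesis eqv_trans : forall x y z, eqv x y -> eqv y z -> eqv x z.
Hypothesis class_cover : forall (W : set Y) x, open W -> ~ W x ->
  exists (E : set Y) (e : I -> Y),
  [/\ E x, E `<=` ~` W, closed_discrete E /\ E `<=` eqv x,
      eqv x `<=` W `|` star U E & E `<=` range e].
Hypothesis small_union : forall i (E : I -> set Y),
  (forall j, closed_discrete (E j)) ->
  (forall j y z, E j y -> E j z -> eqv y z) ->
  (forall j k y z, E j y -> E k z -> eqv y z -> j = k) ->
  closed_discrete (\bigcup_(j in [set j | ~ lt i j]) E j).

(** If points of [D] accumulate at [x], then the basic neighbourhood of [x]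
    contains one of them, and [x] is in [W]. *)
Lemma absorbing_closed_discrete (D W : set Y) :
    absorbing D W ->
    (forall x, W x -> \forall y \near x, D y -> y = x) ->
  closed_discrete D.
Proof.
move=> absD cdW x; have [/cdW //|nWx] := pselect (W x).
have [a xa] := S_near x.
by apply: filterS xa => y Sx Dy; case: nWx; exact: absD Sx.
Qed.

(** The task of treating the points [x] of [S a y] is done by covering one of
    them.  Each class is treated at most once because it is covered entirely at
    that time. *)
Lemma absorbing_extension (W : set Y) x0 : open W -> ~ W x0 ->
  exists D, [/\ closed_discrete D, D `<=` ~` W,
    absorbing D (W `|` star U D) & (W `|` star U D) x0].
Proof.
move=> oW nWx0; have [trlt tolt wflt] := wolt; have [t tP] := tasks.
pose covers (p : set Y * Y) (q : set Y * (I -> Y)) := open p.1 -> ~ p.1 p.2 ->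
  [/\ q.1 p.2, q.1 `<=` ~` p.1, closed_discrete q.1 /\ q.1 `<=` eqv p.2,
      eqv p.2 `<=` p.1 `|` star U q.1 & q.1 `<=` range q.2].
have /choice[c cP] : forall p, exists q, covers p q.
  move=> [V x]; have [[oV nVx]|nVx] := pselect (open V /\ ~ V x).
    by have [E [e EP]] := class_cover oV nVx; exists (E, e).
  by exists (set0, fun=> x0) => oV nV; case: nVx.
pose Wo i (E : I -> set Y * (I -> Y)) : set Y :=
  W `|` \bigcup_(j in [set j | lt j i]) star U (E j).1.
pose cand i (E : I -> set Y * (I -> Y)) : set Y :=
  [set x | if pselect (Wo i E x0) then
    lt (t i).1 i /\ S (t i).2.2 ((E (t i).1).2 (t i).2.1) x else x = x0].
(* [x0] is taken at the first stage, which has no task as it has no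
   predecessor; afterwards a point is chosen only if the task asks for it *)
pose step i E := if pselect (exists x, cand i E x /\ ~ Wo i E x) is left e
  then c (Wo i E, projT1 (cid e)) else (set0, fun=> x0).
have [E EE] := wf_recursion (set0, fun=> x0) step wflt.
pose EW i := Wo i E.
have oEW i : open (EW i).
  apply: openU => //; apply: bigcup_open => j _; exact: open_star.
have {EE} stageP i :
    ((E i).1 = set0 /\ forall x, cand i E x -> EW i x) \/
    exists x, [/\ cand i E x, ~ EW i x & E i = c (EW i, x)].
  pose E' j := if pselect (lt j i) then E j else (set0, fun=> x0).
  have WoE : Wo i E' = EW i.
    congr (_ `|` _); apply: eq_bigcupr => j /= ji.
    by rewrite /E'; case: pselect.
  have candE : cand i E' = cand i E.
    apply/seteqP; split=> x; rewrite /cand /= WoE;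
      case: pselect => //= _ [ti]; rewrite /E'; by case: pselect.
  rewrite EE -/E' /step WoE candE; case: pselect => [e|ne]; [right|left].
    by case: cid => x /= [? ?]; exists x.
  by split=> // x cx; apply: contrapT => nx; apply: ne; exists x.
pose D := \bigcup_i (E i).1.
have EP i : [/\ (E i).1 `<=` ~` EW i, closed_discrete (E i).1,
    forall y z, (E i).1 y -> eqv y z -> (EW i `|` star U (E i).1) z,
    forall y z, (E i).1 y -> (E i).1 z -> eqv y z
    & (E i).1 `<=` range (E i).2].
  have [[-> _]|[x [_ nx ->]]] := stageP i.
    by split=> //; exact: closed_discrete0.
  have [/= cx cW [ccd ceqv] ccov crange] := cP (EW i, x) (oEW i) nx.
  split=> // [y z /ceqv xy yz|y z /ceqv xy /ceqv xz].
    by apply: ccov; exact: eqv_trans yz.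
  exact: eqv_trans (eqv_sym xy) xz.
have candP i x : cand i E x -> (EW i `|` star U (E i).1) x.
  have [[_ +] cx|[y [cy ny Ei]] cx] := stageP i; first by move=> /(_ _ cx); left.
  have [/= cyy _ _ _ _] := cP (EW i, y) (oEW i) ny.
  right; rewrite Ei; exists y => //; move: cx cy; rewrite /cand /=.
  case: pselect => [_ [_ Sx] [_ Sy]|_ -> ->]; first exact: S_sub Sy _ Sx.
  by have [] := nU x0.
have EW_sub i : EW i `|` star U (E i).1 `<=` W `|` star U D.
  move=> x [[Wx|[j ji [y Ey Uy]]]|[y Ey Uy]]; first by left.
  - by right; exists y => //; exists j.
  - by right; exists y => //; exists i.
have EWlt i j : lt i j -> EW i `|` star U (E i).1 `<=` EW j.
  move=> ij x [[Wx|[k ki kx]]|ix]; first by left.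
  - by right; exists k => //; exact: trlt ij.
  - by right; exists i.
have x0i i : (EW i `|` star U (E i).1) x0.
  have [|nx] := pselect (EW i x0); first by left.
  by apply: candP; rewrite /cand /=; case: pselect.
have absD : absorbing D (W `|` star U D).
  move=> y a x [i _ Ey] Sx; have [_ _ _ _ Erange] := EP i.
  have [k _ ky] := Erange y Ey.
  have [j /= ij tj] := tP (i, (k, a)); apply: (EW_sub j).
  apply: candP; rewrite /cand /=; case: pselect => [?|[]] /=.
    by rewrite tj /= ky.
  exact: EWlt ij _ (x0i i).
have EW_disj i j : lt i j -> forall y, (E j).1 y -> ~ (EW i `|` star U (E i).1) y.
  by move=> ij y Ey /(EWlt _ _ ij); have [+ _ _ _ _] := EP j; apply.
have EW_eqv i j y z : (E i).1 y -> (E j).1 z -> eqv y z -> ~ lt i j.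
  move=> Ey Ez yz ij; have [_ _ + _ _] := EP i.
  by move=> /(_ _ _ Ey yz); exact: EW_disj ij _ Ez.
have [i0 _] := S_near x0.
exists D; split=> //; last exact: EW_sub (x0i i0).
- apply: (absorbing_closed_discrete (W := W `|` star U D)) => //.
  move=> x [Wx|[w [i _ Ew] Uwx]].
    apply: filterS (open_nbhs_nbhs (conj oW Wx)) => y Wy [i _ Ey].
    by have [+ _ _ _ _] := EP i; move=> /(_ _ Ey) []; left.
  have smallD : closed_discrete (\bigcup_(j in [set j | ~ lt i j]) (E j).1).
    apply: small_union.
    + by move=> j; have [] := EP j.
    + by move=> j; have [] := EP j.
    + move=> j k u v Eu Ev uv; have [//|jk|kj] := tolt j k.
        by case: (EW_eqv j k u v).
      by case: (EW_eqv k j v u) => //; exact: eqv_sym.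
  have [oU _] := nU w.
  near=> y => -[j _ Ejy].
  have : (\bigcup_(j in [set j | ~ lt i j]) (E j).1) y.
    exists j => //= ij; apply: (EW_disj _ _ ij _ Ejy); right; exists w => //.
    by near: y; exact: open_nbhs_nbhs.
  by near: y; exact: smallD.
- move=> y [i _ Ey] Wy; have [+ _ _ _ _] := EP i.
  by move=> /(_ _ Ey); apply; left.
Unshelve. all: by end_near. Qed.

(** A maximal closed discrete absorbing set covers the space. *)
Theorem covering_closed_discrete :
  exists D, closed_discrete D /\ star U D = setT.
Proof.
pose good D := closed_discrete D /\ absorbing D (star U D).
pose G := {D | good D}.
pose R (D D' : G) := `[< sval D `<=` sval D' /\
  sval D' `&` star U (sval D) `<=` sval D >].
have Rtrans D1 D2 D3 : R D1 D2 -> R D2 D3 -> R D1 D3.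
  move=> /asboolP[s12 d12] /asboolP[s23 d23]; apply/asboolP; split.
    exact: subset_trans s23.
  move=> x [D3x sx]; apply: d12; split=> //; apply: d23; split=> //.
  exact: star_sub sx.
have [||||[D [cdD absD]] Dmax] := @Zorn G R.
- by move=> D; apply/asboolP; split=> // x [].
- exact: Rtrans.
- move=> [D gD] [D' gD'] /asboolP[/= DD' _] /asboolP[/= D'D _].
  have eDD' : D = D' by apply/seteqP; split.
  by rewrite eDD' in gD *; congr exist; exact: Prop_irrelevance.
- move=> A Atot; pose D := \bigcup_(B in A) sval B.
  have initD B : A B -> D `&` star U (sval B) `<=` sval B.
    move=> AB x [[B' AB' B'x] sx].
    have [/asboolP[_ BB']|/asboolP[B'B _]] := Atot _ _ AB AB'.
      by apply: BB'; split.
    exact: B'B.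
  have absD : absorbing D (star U D).
    move=> y a x [B AB By] Sx; have [_ absB] := svalP B.
    by apply: (@star_sub _ U (sval B)) (absB _ _ _ By Sx) => z Bz; exists B.
  have cdD : closed_discrete D.
    apply: (absorbing_closed_discrete (W := star U D)) => //.
    move=> x [w [B AB Bw] Uwx]; have [cdB _] := svalP B.
    have [oU _] := nU w.
    near=> y => Dy; have: sval B y.
      apply: initD => //; split=> //; exists w => //.
      by near: y; exact: open_nbhs_nbhs.
    by near: y; exact: cdB.
  exists (exist good D (conj cdD absD)) => B AB; apply/asboolP; split=> /=.
    by move=> x Bx; exists B.
  exact: initD.
- exists D; split=> //; apply/seteqP; split=> // x0 _; apply: contrapT => nx0.
  have [D' [cdD' D'W absD' D'x0]] := absorbing_extension (open_star _ nU) nx0.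
  have starE : star U (D `|` D') = star U D `|` star U D' by exact: bigcup_setU.
  have gDD' : good (D `|` D').
    split; first exact: closed_discreteU.
    rewrite starE => y a x [Dy|D'y] Sx; last exact: (absD' y a).
    by left; exact: (absD y a).
  have : R (exist good D (conj cdD absD)) (exist good _ gDD').
    apply/asboolP; split=> /=; first by move=> x; left.
    by move=> x [[//|/D'W]].
  move=> /Dmax [eD]; apply: nx0; rewrite -eD starE.
  exact: D'x0.
Unshelve. all: by end_near. Qed.

End covering.

(** * Eventual equality *)

Lemma eq_starP (X : topologicalType) (x y : box X) :
  eq_star x y <-> \forall n \near \oo, x n = y n.
Proof.
split=> [/asboolP /finite_seqP[s sE]|[N _ xyN]]; last first.
  apply/asboolP; apply: (sub_finite_set _ (finite_II N)) => n /= nxy.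
  by rewrite ltnNge; apply/negP => /xyN.
exists (\max_(n <- s) n).+1 => // n /= sn; apply: contrapT => nxy.
have : [set` s] n by rewrite -sE.
move=> /= ns; have : (n <= \max_(i <- s) i)%N by apply: leq_bigmax_seq.
by rewrite leqNgt => /negP; apply.
Qed.

Lemma eq_star_refl (X : topologicalType) (x : box X) : eq_star x x.
Proof. by apply/eq_starP; apply: nearW. Qed.

Lemma eq_star_sym (X : topologicalType) (x y : box X) :
  eq_star x y -> eq_star y x.
Proof. by move=> /eq_starP xy; apply/eq_starP; apply: filterS xy. Qed.

Lemma eq_star_trans (X : topologicalType) (x y z : box X) :
  eq_star x y -> eq_star y z -> eq_star x z.
Proof.
move=> /eq_starP xy /eq_starP yz; apply/eq_starP.
by apply: filterS2 xy yz => n ->.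
Qed.

Lemma maximal_separated (T : Type) (rel : T -> T -> Prop) (S : set T) :
  (forall x y, rel x y -> rel y x) -> (forall x, rel x x) ->
  exists E, [/\ E `<=` S, forall y z, E y -> E z -> rel y z -> y = z
    & forall s, S s -> exists2 y, E y & rel y s].
Proof.
move=> rsym rrefl.
pose sep E := E `<=` S /\ forall y z, E y -> E z -> rel y z -> y = z.
have [|E [[ES Esep] Emax]] := @Zorn_bigcup _ sep.
  move=> F Fsep Ftot; split; first by move=> x [E /Fsep[ES _]]; exact: ES.
  move=> y z [E FE Ey] [E' FE' E'z].
  have [/(_ _ Ey) E'y|/(_ _ E'z) Ez] := Ftot _ _ FE FE'.
    by have [_] := Fsep _ FE'; exact.
  by have [_] := Fsep _ FE; exact.
exists E; split=> // s Ss; apply: contrapT => ns.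
have Es y : E y -> ~ rel y s by move=> Ey ys; apply: ns; exists y.
apply: (Emax (E `|` [set s])).
  split; first by move=> z; left.
  by move=> sub; apply: (Es s) => //; apply: sub; right.
split; first by move=> x [/ES|->].
move=> y z [Ey|->] [Ez|->] //; first exact: Esep.
  by move=> /(Es _ Ey).
by move=> /rsym /(Es _ Ez).
Qed.

(** * Sequences close along a filter *)

Section metric.
Local Open Scope ring_scope.
Context {R : realType} {X : topologicalType} (d : X -> X -> R).
Hypothesis d0 : forall x y, d x y = 0 <-> x = y.
Hypothesis dC : forall x y, d x y = d y x.
Hypothesis dD : forall x y z, d x z <= d x y + d y z.

Lemma metric_ge0 x y : 0 <= d x y.
Proof.
have : d x x <= d x y + d y x by exact: dD.
have -> : d x x = 0 by exact/d0.
by rewrite (dC y x); lra.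
Qed.

Lemma inv_nat_le (e : R) : 0 < e -> exists k : nat, k.+1%:R^-1 <= e.
Proof.
move=> e0; have [k _ ke] := near_infty_natSinv_lt (PosNum e0).
by exists k; apply: ltW; have := ke k (leqnn k).
Qed.

Lemma metric_gt0 x y : x <> y -> exists k : nat, k.+1%:R^-1 <= d x y.
Proof.
move=> xy; apply: inv_nat_le; rewrite lt_neqAle metric_ge0 andbT eq_sym.
by apply/eqP => /d0.
Qed.

Lemma inv_nat_half k : (k.*2.+2%:R : R)^-1 + k.*2.+2%:R^-1 = k.+1%:R^-1.
Proof.
have -> : k.*2.+2 = (k.+1 * 2)%N by rewrite muln2 doubleS.
rewrite natrM invfM -mulrDr -[RHS]mulr1; congr (_ * _); lra.
Qed.

(** [Phi] is the filter of all cofinite sets for the nabla product, and the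
    trivial filter for the box product. *)
Definition close_along (Phi : set_system nat) (f : nat -> nat)
    (x y : nat -> X) : Prop :=
  Phi [set n | d (x n) (y n) < (f n).+1%:R^-1].

Section filter.
Variables (Phi : set_system nat).
Context {FPhi : Filter Phi}.

Lemma close_sym f x y : close_along Phi f x y -> close_along Phi f y x.
Proof. by apply: filterS => n /=; rewrite dC. Qed.

Lemma close_le f g x y :
  (forall n, (f n <= g n)%N) -> close_along Phi g x y -> close_along Phi f x y.
Proof.
move=> fg; apply: filterS => n /= xy; apply: (lt_le_trans xy).
by rewrite lef_pV2 ?posrE // ler_nat ltnS.
Qed.

Lemma close_trans f x y z : close_along Phi (fun n => (f n).*2.+1) x y ->
  close_along Phi (fun n => (f n).*2.+1) y z -> close_along Phi f x z.
Proof.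
apply: filterS2 => n /= xy yz; apply: (le_lt_trans (dD _ (y n) _)).
by rewrite -inv_nat_half ltrD.
Qed.

End filter.

(** For each [j] some coordinate [k >= n] has [1 / (h j n + 1) <= d (x k) (y j k)].
    If [f n > h j n] for infinitely many [n], then at the corresponding [k] the
    monotone function [k |-> max (f 0, ..., f k)] exceeds [h j n] too, so [y j] stays
    outside of the neighbourhood of [x] that it defines; and so does every [z]
    eventually equal to [y j]. *)
Lemma few_classes_far (J : Type) (S : set J) (y : J -> box X) (x : box X) :
  (forall j, S j -> ~ eq_star x (y j)) -> (forall h, ~ star_dominating S h) ->
  exists f, forall j z, S j -> eq_star (y j) z -> ~ close_along \oo f x z.
Proof.
move=> xS Ssmall.
have /choice[h hP] : forall j, exists h : nat -> nat, S j -> forall n,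
    exists2 k, (n <= k)%N & (h n).+1%:R^-1 <= d (x k) (y j k).
  move=> j; have [Sj|nSj] := pselect (S j); last by exists id.
  suff /choice[h hP] : forall n, exists m, exists2 k, (n <= k)%N &
      m.+1%:R^-1 <= d (x k) (y j k) by exists h.
  move=> n; have [k [nk xyk]] : exists k, (n <= k)%N /\ x k <> y j k.
    apply: contrapT => nk; apply: (xS j Sj); apply/eq_starP.
    exists n => // k nk'; apply: contrapT => xyk; apply: nk; exists k.
    by split.
  by have [m xym] := metric_gt0 xyk; exists m, k.
have [f fP] : exists f, forall j, S j -> ~ \forall n \near \oo, (f n <= h j n)%N.
  have /existsNP[f /forall2NP fP] := Ssmall h; exists f => j Sj.
  by have [|] := fP j.
exists (fun n => \max_(m < n.+1) f m)%N => j z Sj yz xz; apply: (fP j Sj).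
have /eq_starP yz' := yz.
have [N _ NP] : \forall n \near \oo, y j n = z n /\
    d (x n) (z n) < (\max_(m < n.+1) f m).+1%:R^-1.
  exact: filterI yz' xz.
exists N => // n /= Nn; rewrite leqNgt; apply/negP => hf.
have [k nk xyk] := hP j Sj n.
have [yzk xzk] := NP k (leq_trans Nn nk).
move: xyk; rewrite yzk leNgt => /negP; apply; apply: (lt_le_trans xzk).
rewrite lef_pV2 ?posrE // ler_nat ltnS; apply: (leq_trans (ltnW hf)).
have nk1 : (n < k.+1)%N by rewrite ltnS.
exact: (@leq_bigmax _ (fun i : 'I_k.+1 => f i) (Ordinal nk1)).
Qed.

(** * Spaces of sequences with uniform neighbourhoods *)

(* Subspaces of box products and of nabla products are treated together, the
   latter through representatives [r] of the classes. *)

Section product_like.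
Context {Y : topologicalType} (r : Y -> box X) (Phi : set_system nat).
Context {FPhi : Filter Phi}.
Hypothesis Phi_oo : Phi `<=` \oo.
Hypothesis nbhsY : forall y V,
  nbhs y V <-> exists f, [set z | close_along Phi f (r y) (r z)] `<=` V.

Lemma nbhs_close y f : \forall z \near y, close_along Phi f (r y) (r z).
Proof. by apply/nbhsY; exists f. Qed.

Lemma close_oo f x y : close_along Phi f x y -> close_along \oo f x y.
Proof. exact: Phi_oo. Qed.

(** The classes of eventual equality are closed: the case of [few_classes_far]
    for a single class. *)
Lemma near_other_class x y : ~ eq_star (r y) (r x) ->
  \forall z \near y, ~ eq_star (r x) (r z).
Proof.
move=> nyx.
have [|h|f fP] := @few_classes_far nat setT (fun=> r x) (r y).
- by [].
- exact: countable_not_star_dominating.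
- near=> z => xz; apply: (fP 0%N _ _ xz) => //; apply: close_oo.
  by near: z; exact: nbhs_close.
Unshelve. all: by end_near. Qed.

Section covering.
Context {I : Type} {lt : I -> I -> Prop} {g : I -> nat -> nat}.
Hypothesis index : dominating_index lt g.

Lemma small_union_closed_discrete i (E : I -> set Y) :
  (forall j, closed_discrete (E j)) ->
  (forall j y z, E j y -> E j z -> eq_star (r y) (r z)) ->
  (forall j k y z, E j y -> E k z -> eq_star (r y) (r z) -> j = k) ->
  closed_discrete (\bigcup_(j in [set j | ~ lt i j]) E j).
Proof.
move=> cdE Eeqv Edisj x.
pose y j := if pselect (exists z, E j z) is left e then projT1 (cid e) else x.
have yP j z : E j z -> E j (y j).
  by move=> Ez; rewrite /y; case: pselect => [e|[]]; [case: cid|exists z].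
pose S := [set j | ~ lt i j /\ ~ eq_star (r x) (r (y j))].
have [|h hdom|f fP] := @few_classes_far _ S (r \o y) (r x).
- by move=> j [].
- apply: (@dindex_small _ _ _ index i h) => k.
  by have [j [ij _] kj] := hdom k; exists j.
have cd0 : \forall z \near x, forall j, E j z -> eq_star (r x) (r z) -> z = x.
  have [[j [u Eu xu]]|nj] :=
    pselect (exists j, exists2 u, E j u & eq_star (r x) (r u)); last first.
    by apply: nearW => z j Ez xz; case: nj; exists j, z.
  apply: filterS (cdE j x) => z zx k Ez xz; apply: zx.
  rewrite (Edisj j k u z) //; exact: eq_star_trans (eq_star_sym xu) xz.
near=> z => -[j /= ij Ez].
have [xy|nxy] := pselect (eq_star (r x) (r (y j))).
  have: forall j, E j z -> eq_star (r x) (r z) -> z = x by near: z; exact: cd0.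
  by move=> /(_ _ Ez); apply; exact: eq_star_trans xy (Eeqv _ _ _ (yP _ _ Ez) Ez).
exfalso; apply: (fP j (r z)) => //.
  exact: (Eeqv _ _ _ (yP _ _ Ez) Ez).
by apply: close_oo; near: z; exact: nbhs_close.
Unshelve. all: by end_near. Qed.

(** What remains to be shown for each product: inside a class, there is a
    closed discrete set of at most [I] points to start from. *)
Definition class_coverable (U : Y -> set Y) : Prop :=
  forall (W : set Y) x, open W -> ~ W x ->
  exists (E : set Y) (e : I -> Y),
  [/\ E x, E `<=` ~` W,
      closed_discrete E /\ E `<=` [set y | eq_star (r x) (r y)],
      [set y | eq_star (r x) (r y)] `<=` W `|` star U E & E `<=` range e].

(** A point [x] gets an index [a] such that [U x] contains the neighbourhood
    of [x] of index [a]; but its basic neighbourhood is the one of half the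
    radius.  Then two points of index [a] whose basic neighbourhoods share a
    point [y] belong to each other's [U]. *)
Lemma D_space_of_class_coverable :
  (forall U, neighbornet U -> class_coverable U) -> D_space Y.
Proof.
move=> cover U nU.
pose dbl (f : nat -> nat) n := (f n).*2.+1.
pose S a y : set Y := [set x | close_along Phi (dbl (g a)) (r x) (r y) /\
  [set z | close_along Phi (g a) (r x) (r z)] `<=` U x].
have [p pP] := dindex_pair index.
have tasks : exists t : I -> I * (I * I),
    forall u, exists2 i, lt u.1 i & t i = u.
  pose q i := p (p i).2; pose s i := p (q i).2.
  exists (fun i => ((p i).1, ((q i).1, (s i).1))) => -[j [k a]].
  apply: contrapT => nt.
  apply: (@dindex_small _ _ _ index j (fun i => g (s i).2)) => f.
  have [b fb] := dindex_dom index f.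
  have [i3 e3] := pP (a, b); have [i2 e2] := pP (k, i3); have [i1 e1] := pP (j, i2).
  exists i1; last by apply: nearW => n; rewrite /s /q e1 /= e2 /= e3.
  move=> /= ji; apply: nt; exists i1 => //.
  by rewrite /s /q e1 /= e2 /= e3.
have [||||||D [cdD DT]] := @covering_closed_discrete _ U
    (fun x y => eq_star (r x) (r y)) I lt S nU (dindex_wo index) tasks.
- move=> a y x [xy sU] z [zy _]; apply: sU => /=.
  exact: close_trans xy (close_sym zy).
- move=> x; have [oU Ux] := nU x.
  have /nbhsY[f fU] : nbhs x (U x) by exact: open_nbhs_nbhs.
  have [a fa] := dindex_dom index f; exists a.
  apply: filterS (nbhs_close x (dbl (g a))) => y xy; split=> // z xz.
  by apply: fU; exact: close_le xz.
- by move=> x y; exact: eq_star_sym.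
- by move=> x y z; exact: eq_star_trans.
- exact: cover.
- exact: small_union_closed_discrete.
by have [clD discD] := closed_discreteP cdD; exists D; split.
Qed.

End covering.
End product_like.
End metric.

(** * Neighbourhoods in the two products *)

Lemma open_open_box (X : topologicalType) (V : nat -> set X) :
  (forall n, open (V n)) -> open (open_box V).
Proof.
move=> oV; exists [set V]; first by move=> _ ->.
by rewrite bigcup_set1.
Qed.

Lemma nbhs_open_box (X : topologicalType) (x : box X) (V : set (box X)) :
  nbhs x V -> exists W, [/\ forall n, open (W n), open_box W x & open_box W `<=` V].
Proof.
rewrite nbhsE => -[_ [[D oD <-] [W DW Wx]] DV].
by exists W; split=> // [n|z Wz]; [exact: oD|apply: DV; exists W].
Qed.

Section products.
Local Open Scope ring_scope.
Context {R : realType} {X : topologicalType} (d : X -> X -> R).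
Hypothesis d0 : forall x y, d x y = 0 <-> x = y.
Hypothesis dC : forall x y, d x y = d y x.
Hypothesis dD : forall x y z, d x z <= d x y + d y z.
Hypothesis dnbhs : forall x, nbhs x = nbhs_ball_ (fun y e => [set z | d y z < e]) x.

Lemma nbhs_metric x V :
  nbhs x V <-> exists k : nat, [set y | d x y < k.+1%:R^-1] `<=` V.
Proof.
rewrite dnbhs; split=> [[e /= e0 eV]|[k kV]].
  have [k ke] := inv_nat_le e0; exists k => y /= xy; apply: eV => /=.
  exact: lt_le_trans ke.
by exists k.+1%:R^-1 => //=; rewrite invr_gt0.
Qed.

Lemma nbhs_box (x : box X) V :
  nbhs x V <-> exists f, [set z | close_along d (globally setT) f x z] `<=` V.
Proof.
split=> [/nbhs_open_box[W [oW Wx WV]]|[f fV]].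
  have /choice[f fP] n : exists k : nat, [set y | d (x n) y < k.+1%:R^-1] `<=` W n.
    by apply/nbhs_metric; apply: open_nbhs_nbhs; split=> //; exact: Wx.
  by exists f => z xz; apply: WV => n; apply: fP; exact: xz.
apply: (filterS fV); pose W n := [set y | d (x n) y < (f n).+1%:R^-1]°.
have : nbhs x (open_box W).
  apply: open_nbhs_nbhs; split.
    by apply: open_open_box => n; exact: open_interior.
  by move=> n; apply/nbhs_metric; exists (f n).
by apply: filterS => z Wz n _; exact: (@interior_subset X _ _ (Wz n)).
Qed.

Lemma nabla_eqP (x y : box X) :
  \pi_(nabla X)%qT x = \pi_(nabla X)%qT y <-> eq_star x y.
Proof. by split=> [/eqmodP|xy]; [|apply/eqmodP]. Qed.

Lemma repr_pi (x : box X) : eq_star (repr (\pi_(nabla X)%qT x)) x.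
Proof. by apply/nabla_eqP; rewrite reprK. Qed.

Lemma nbhs_nabla (y : nabla X) V :
  nbhs y V <-> exists f, [set z | close_along d \oo f (repr y) (repr z)] `<=` V.
Proof.
split=> [|[f fV]].
  rewrite nbhsE => -[B [oB By] BV].
  have /nbhs_box[f fB] : nbhs (repr y) (\pi_(nabla X)%qT @^-1` B).
    by apply: open_nbhs_nbhs; split=> //; rewrite /= reprK.
  exists f => z yz; apply: BV.
  (* correct [repr z] at the finitely many coordinates where it is far *)
  pose w : box X := fun n => if d (repr y n) (repr z n) < (f n).+1%:R^-1
    then repr z n else repr y n.
  have <- : \pi_(nabla X)%qT w = z.
    rewrite -[z]reprK; apply/nabla_eqP/eq_starP.
    by apply: filterS yz => n; rewrite /w => /= ->.
  apply: fB => n _ /=; rewrite /w; case: ifP => // _.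
  by have -> : d (repr y n) (repr y n) = 0 by exact/d0.
(* a neighbourhood of the class of [y] that is saturated and open *)
pose O : set (box X) := [set w | \forall n \near \oo,
  ([set u | d (repr y n) u < (f n).+1%:R^-1]°) (w n)].
have satO u v : eq_star u v -> O u -> O v.
  by move=> /eq_starP uv; apply: filterS2 uv => n ->.
have oO : open O.
  rewrite openE => w Ow; rewrite /interior.
  pose W n : set X := if `[< ([set u | d (repr y n) u < (f n).+1%:R^-1]°) (w n) >]
    then [set u | d (repr y n) u < (f n).+1%:R^-1]° else setT.
  have : nbhs w (open_box W).
    apply: open_nbhs_nbhs; split.
      apply: open_open_box => n; rewrite /W; case: ifP => _.
        exact: open_interior.
      exact: openT.
    by move=> n; rewrite /W; case: asboolP.
  apply: filterS => v Wv; apply: filterS Ow => n wn.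
  by have := Wv n; rewrite /W; case: asboolP.
apply: (filterS fV).
have : nbhs y [set z : nabla X | O (repr z)].
  apply: open_nbhs_nbhs; split; last first.
    by apply: nearW => n; apply/nbhs_metric; exists (f n).
  rewrite /open /= /quotient_open (_ : _ @^-1` _ = O) //.
  apply/seteqP; split=> w; apply: satO; first exact: repr_pi.
  exact/eq_star_sym/repr_pi.
by apply: filterS => z; apply: filterS => n; exact: interior_subset.
Qed.

Lemma nbhs_subtype (Y : topologicalType) (r : Y -> box X) Phi (A : set Y) :
  (forall y V, nbhs y V <->
    exists f, [set z | close_along d Phi f (r y) (r z)] `<=` V) ->
  forall (y : A) V, nbhs y V <->
    exists f, [set z : A | close_along d Phi f (r (val y)) (r (val z))] `<=` V.
Proof.
move=> nbhsY y V; split=> [|[f fV]].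
  rewrite nbhsE => -[_ [[B oB <-] By] BV].
  have /nbhsY[f fB] : nbhs (val y) B by exact: open_nbhs_nbhs.
  by exists f => z yz; apply: BV; exact: fB.
have : nbhs (val y) [set z | close_along d Phi f (r (val y)) (r z)].
  by apply/nbhsY; exists f.
move=> /(@initial_continuous A Y set_val y).
exact: (@filterS _ (nbhs y) _ _ _ fV).
Qed.

(** * The two products are hereditarily D *)

Section covering.
Context {I : Type} {lt : I -> I -> Prop} {g : I -> nat -> nat}.
Hypothesis index : dominating_index lt g.

Lemma nabla_hereditarily_D : hereditarily_D (nabla X).
Proof.
move=> A.
pose r (y : nabla X) : box X := repr y.
have nbhsA := nbhs_subtype (Y := nabla X) (r := r) (A := A) nbhs_nabla.
have oo_sub : nbhs \oo `<=` \oo by [].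
apply: (D_space_of_class_coverable (Y := A) (r := r \o val) (Phi := nbhs \oo) d0 dC dD
  oo_sub nbhsA index) => U nU W x oW nWx.
have x_inj (y : A) : eq_star (repr (val x)) (repr (val y)) -> x = y.
  by move=> /nabla_eqP; rewrite !reprK => /val_inj.
have [_ Ux] := nU x.
exists [set x], (fun=> x); split=> //.
- by move=> _ ->.
- split; last by move=> _ ->; exact: eq_star_refl.
  apply: closed_discrete1 => y nyx.
  have nrx : ~ eq_star ((r \o val) y) ((r \o val) x).
    by move=> /eq_star_sym /x_inj /esym.
  apply: filterS (near_other_class d0 dC dD oo_sub nbhsA nrx) => z nxz zx.
  by apply: nxz; rewrite zx; exact: eq_star_refl.
- by move=> y /x_inj <-; right; exists x.
- by move=> _ ->; have [i _] := dindex_dom index id; exists i.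
Qed.

(** The pieces [C m] are covered in turn, each by points that the earlier ones
    have left uncovered.  Every point of [cl] is covered at a finite stage, so
    near it only finitely many closed discrete sets are met. *)
Lemma countable_class_cover (Y : topologicalType) (U : Y -> set Y) (C : nat -> set Y)
    (cl W : set Y) (x : Y) :
  neighbornet U -> cl x -> cl = \bigcup_m C m -> closed cl ->
  (forall m T, T `<=` C m -> exists (E : set Y) (e : I -> Y),
    [/\ E `<=` T, closed_discrete E, T `<=` star U E & E `<=` range e]) ->
  closed_discrete [set x] -> open W -> ~ W x ->
  exists (E : set Y) (e : I -> Y), [/\ E x, E `<=` ~` W,
    closed_discrete E /\ E `<=` cl, cl `<=` W `|` star U E & E `<=` range e].
Proof.
move=> nU clx clC ccl Ccover cdx oW nWx.
have /choice[c cP] : forall p : nat * set Y, exists q : set Y * (I -> Y),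
    [/\ q.1 `<=` C p.1 `\` p.2, closed_discrete q.1,
        C p.1 `\` p.2 `<=` star U q.1 & q.1 `<=` range q.2].
  move=> [m V]; have [E [e EP]] := Ccover m (C m `\` V) (@subDsetl _ _ _).
  by exists (E, e).
pose V := fix V m := if m is n.+1 then V n `|` star U (c (n, V n)).1
  else W `|` U x.
pose E m := (c (m, V m)).1.
have oV m : open (V m).
  elim: m => [|m IH] /=; apply: openU => //; last exact: open_star.
  by have [] := nU x.
have V_le m n : (m <= n)%N -> V m `<=` V n.
  move=> /subnK <-; elim: (n - m)%N => // k IH y Vy.
  by left; exact: IH.
have EV m n y : (m <= n)%N -> V m y -> ~ E n y.
  by move=> mn /(V_le _ _ mn) Vy Ey; have [+ _ _ _] := cP (n, V n); case/(_ _ Ey).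
have VE m : V m `<=` W `|` star U ([set x] `|` \bigcup_n E n).
  elim: m => [|m IH] y /= [].
  - by left.
  - by move=> Uxy; right; exists x => //; left.
  - exact: IH.
  - by move=> [z Ez Uzy]; right; exists z => //; right; exists m.
have clV y : cl y -> exists m, V m y.
  rewrite clC => -[m _ Cy]; have [Vy|nVy] := pselect (V m y); first by exists m.
  by exists m.+1; right; have [_ _ + _] := cP (m, V m); apply.
have Ecl m : E m `<=` cl.
  move=> y Ey; rewrite clC; exists m => //.
  by have [+ _ _ _] := cP (m, V m); case/(_ _ Ey).
have [p pP] := dindex_pair index; have [q qP] := dindex_nat index.
exists ([set x] `|` \bigcup_n E n).
exists (fun i => if q (p i).1 is n.+1 then (c (n, V n)).2 (p i).2 else x).
split.
- by left.
- move=> y [->//|[m _ Ey] Wy]; apply: (EV 0%N m y) => //; by left.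
- split; last by move=> y [->//|[m _ /Ecl]].
  apply: closed_discreteU => // z.
  have [[m Vz]|nVz] := pselect (exists m, V m z).
    near=> y => -[n _ Ey].
    have nm : (n < m)%N.
      rewrite ltnNge; apply/negP => mn; apply: (EV m n y) => //.
      by near: y; apply: open_nbhs_nbhs.
    have : forall n : 'I_m, E n y -> y = z.
      near: y; apply: filter_forall => k.
      by have [_ + _ _] := cP (val k, V (val k)); apply.
    by move=> /(_ (Ordinal nm)); apply.
  have ncl : (~` cl) z by move=> /clV.
  have : nbhs z (~` cl) by apply: open_nbhs_nbhs; split=> //; exact: closed_openC.
  by apply: filterS => y ny [m _ /Ecl].
- by move=> y /clV[m]; exact: VE.
- have toI n j : exists i, q (p i).1 = n /\ (p i).2 = j.
    by have [k kn] := qP n; have [i ip] := pP (k, j); exists i; rewrite ip.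
  have [i0 _] := dindex_dom index id.
  move=> y [->|[m _ Ey]].
    by have [i [i1 _]] := toI 0%N i0; exists i; rewrite ?i1.
  have [_ _ _ /(_ _ Ey) [j _ <-]] := cP (m, V m).
  by have [i [i1 i2]] := toI m.+1 j; exists i; rewrite ?i1 ?i2.
Unshelve. all: by end_near. Qed.

Variable b : I -> set X.
Hypothesis b_base : forall x (k : nat), exists i,
  b i x /\ forall y, b i y -> d x y < k.+1%:R^-1.

(** Let [m] be the number of the pair [(N, k)].  The piece [C m] of the class of [x]
    consists of the [y] that agree with [x] from [N] on and for which [U y] contains
    the ball of radius [1 / (k + 1)] around [y], for the maximum of the distances
    at the coordinates below [N], among the points that agree with [x] from [N] on.
    A maximal subset of such points at mutual distance at least [1 / (k + 1)] is
    closed discrete, and its points are told apart by [N] indices of basic open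
    sets of [X] of radius [1 / (2 k + 2)], hence by one element of [I]. *)
Lemma box_hereditarily_D : hereditarily_D (box X).
Proof.
move=> A.
have nbhsA : forall (y : A) (V : set A), nbhs y V <-> exists f,
    [set z : A | close_along d (globally setT) f (val y) (val z)] `<=` V.
  exact: (nbhs_subtype (Y := box X) (r := id) nbhs_box).
have Phi_oo : globally [set: nat] `<=` \oo.
  by move=> P PT; exists 0%N => // n _; exact: PT.
apply: (D_space_of_class_coverable (Y := A) (r := val) d0 dC dD Phi_oo nbhsA index).
move=> U nU W x oW nWx.
pose near_tail N k (y z : box X) := forall n, (n < N)%N -> d (y n) (z n) < k.+1%:R^-1.
pose tail N (y : box X) := forall n, (N <= n)%N -> y n = val x n.
(* the radius is uniform, although [U y] is given by a different radius at each
   coordinate: only the finitely many coordinates below [N] matter *)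
pose C m : set A := if (unpickle m : option (nat * nat)) is Some (N, k) then
  [set y | tail N (val y) /\
    forall z : A, tail N (val z) -> near_tail N k (val y) (val z) -> U y z] else set0.
have T1 (y z : A) : y <> z -> \forall u \near y, u <> z.
  move=> nyz; have [n yzn] : exists n, val y n <> val z n.
    apply/existsNP => yz; apply: nyz; apply/val_inj/funext => n; exact: yz.
  have [k kyz] := metric_gt0 d0 dC dD yzn.
  apply: filterS (nbhs_close nbhsA y (fun=> k)) => u yu uz.
  by have := yu n Logic.I; rewrite /= uz ltNge kyz.
apply: (@countable_class_cover _ U C) => //.
- exact: eq_star_refl.
- apply/seteqP; split=> y /=; last first.
    move=> [m _]; rewrite /C; case: unpickle => [[N k] [ty _]|//].
    by apply/eq_star_sym/eq_starP; exists N.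
  move=> /eq_star_sym/eq_starP[N _ Ny].
  have /nbhsA[f fU] : nbhs y (U y) by apply: open_nbhs_nbhs; exact: nU.
  exists (pickle (N, \max_(n < N) f n)%N) => //; rewrite /C pickleK; split=> // z tz yz.
  apply: fU => n _ /=; have [nN|Nn] := ltnP n N.
    apply: (lt_le_trans (yz n nN)); rewrite lef_pV2 ?posrE // ler_nat ltnS.
    exact: (@leq_bigmax _ (fun i : 'I_N => f i) (Ordinal nN)).
  rewrite tz // -[val x n](Ny n Nn).
  by have -> : d (val y n) (val y n) = 0 by exact/d0.
- rewrite -[X in closed X]setCK; apply: open_closedC; rewrite openE => y nxy.
  apply: (near_other_class d0 dC dD Phi_oo nbhsA) => yx; apply: nxy.
  exact: eq_star_sym.
- move=> m T TC; case mE : (unpickle m : option (nat * nat)) => [[N k]|]; last first.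
    exists set0, (fun=> x); split=> //; first exact: closed_discrete0.
    by move=> y /TC; rewrite /C mE.
  have {}TC y : T y -> tail N (val y) /\
      forall z : A, tail N (val z) -> near_tail N k (val y) (val z) -> U y z.
    by move=> /TC; rewrite /C mE.
  have [|y|E [ET Esep Emax]] := @maximal_separated A
    (fun y z => near_tail N k (val y) (val z)) T.
  + by move=> y z yz n nN; rewrite dC; exact: yz.
  + move=> n _; have -> : d (val y n) (val y n) = 0 by exact/d0.
    by rewrite invr_gt0.
  have tri (u y z : A) : near_tail N k.*2.+1 (val u) (val y) ->
      near_tail N k.*2.+1 (val u) (val z) -> near_tail N k (val y) (val z).
    move=> uy uz n nN; apply: (le_lt_trans (dD _ (val u n) _)).
    by rewrite -inv_nat_half ltrD //; [rewrite dC; exact: uy|exact: uz].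
  have [i0 _] := dindex_dom index id; have [p pP] := dindex_pair index.
  pose dec := fix dec M i := if M is M'.+1 then (p i).1 :: dec M' (p i).2 else [::].
  have decP s : exists i, dec (size s) i = s.
    elim: s => [|j s [i iE]] /=; first by exists i0.
    by have [i' i'E] := pP (j, i); exists i'; rewrite i'E /= iE.
  pose coded i (y : A) := E y /\ forall n, (n < N)%N ->
    b (nth i0 (dec N i) n) (val y n) /\
    forall z, b (nth i0 (dec N i) n) z -> d (val y n) z < k.*2.+2%:R^-1.
  exists E, (fun i => if pselect (exists y, coded i y) is left e
    then projT1 (cid e) else x); split=> //.
  + move=> u.
    have [[z [Ez nzu uz]]|nz] := pselect (exists z, [/\ E z, z <> u &
        close_along d (globally setT) (fun=> k.*2.+1) (val u) (val z)]).
      near=> y => Ey; exfalso; have: y <> z by near: y; apply: T1 => /esym.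
      apply; apply: Esep => //; apply: (tri u) => n _; last exact: uz.
      have : close_along d (globally setT) (fun=> k.*2.+1) (val u) (val y).
        by near: y; exact: (nbhs_close nbhsA u (fun=> k.*2.+1)).
      by apply.
    near=> y => Ey; apply: contrapT => yu; apply: nz; exists y; split=> //.
    by near: y; exact: (nbhs_close nbhsA u (fun=> k.*2.+1)).
  + move=> y Ty; have [z Ez zy] := Emax y Ty.
    have [_ zU] := TC z (ET z Ez); have [ty _] := TC y Ty.
    by exists z => //; exact: zU.
  + move=> y Ey.
    have /choice[c cP] : forall n, exists i, b i (val y n) /\
      forall z, b i z -> d (val y n) z < k.*2.+2%:R^-1 by move=> n; exact: b_base.
    have [i] := decP (mkseq c N); rewrite size_mkseq => decE.
    have codedy : coded i y.
      by split=> // n nN; rewrite decE nth_mkseq.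
    exists i => //; case: pselect => [e|[]]; last by exists y.
    case: cid => z /= [Ez zP]; apply: Esep => // n nN.
    have [_ zn] := zP n nN; have [_ /(_ _ nN)[yn _]] := codedy.
    apply: (lt_trans (zn _ yn)).
    by rewrite ltf_pV2 ?posrE // ltr_nat !ltnS -addnn leq_addr.
- by apply: closed_discrete1 => y; exact: T1.
Unshelve. all: by end_near. Qed.

End covering.
End products.

Theorem theorem31 (R : realType) (X : topologicalType) :
  metrizable R X ->
  hereditarily_D (nabla X) /\ (weight_le_d X -> hereditarily_D (box X)).
Proof.
move=> [d [d0 dC dD dnbhs]].
have [I [lt [g index]]] := dominating_index_exists.
split=> [|[B [F [[[Bopen Bbase] _] [Fcof Fmin] BF]]]].
  exact: (nabla_hereditarily_D d0 dC dD dnbhs index).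
have gcof : cofinal_family (range g).
  by move=> f; have [i fi] := dindex_dom index f; exists (g i) => //; exists i.
(* the range of [g] is cofinal, so the least size of a cofinal family is at
   most that of [I] *)
have BI : B #<= [set: I].
  apply: card_le_trans BF _; apply: card_le_trans (Fmin _ gcof) _.
  exact: card_image_le.
have [b Bb] : exists b : I -> set X, B `<=` range b.
  have [f] : $|{injfun [set: B] >-> [set: [set: I]]}| by exact/card_leP.
  exists (fun i => if pselect (exists V : B, val (f V) = i) is left e
    then val (projT1 (cid e)) else set0) => V BV.
  pose V' : B := SigSub (mem_set BV).
  exists (val (f V')) => //; case: pselect => [e|[]]; last by exists V'.
  case: cid => W /= /val_inj fW.
  by have -> : W = V' by apply: (@inj _ _ [set: B] f) => //; exact: mem_set.
apply: (box_hereditarily_D d0 dC dD dnbhs index (b := b)) => x k.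
have [V [BV Vx] Vk] : filter_from [set V | B V /\ V x] id
    [set y | d x y < k.+1%:R^-1]%R.
  by apply: Bbase; apply/(nbhs_metric dnbhs); exists k.
have [i _ iV] := Bb V BV.
by exists i; rewrite iV; split=> // y /Vk.
Qed.
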